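(* Let $1\le k<n$ be integers, let $m=n-k$, and let $\pi$ be a permutation of $\{1,\dots,k\}$, regarded also as a permutation of $\{1,\dots,n\}$ that fixes each of $k+1,\dots,n$. Then there are isomorphisms of posets $$\mathrm{Fix}(\pi,D_n)\;\cong\;\mathrm{Fix}(\pi,D_k)^{B^m}\;\cong\;D_m^{\mathrm{Cycl}(\pi,B^k)}.$$
   Context: $B=\{0,1\}$ with $0\le 1$, and $B^n$ is the set of functions $\{1,\dots,n\}\to B$ (equivalently, $n$-bit strings) with the componentwise order. For posets $S,T$, $T^S$ denotes the poset of all monotone (order-preserving) functions $S\to T$ with pointwise order: $f\le g$ iff $f(x)\le g(x)$ for all $x\in S$. $D_n=B^{B^n}$ is the poset of monotone Boolean functions of $n$ variables. A permutation $\sigma$ of $\{1,\dots,n\}$ acts on $B^n$ by $\sigma(x)=x\circ\sigma$, and acts on $D_n$ by $\sigma(g)=g\circ\sigma$, i.e. $\sigma(g)(x)=g(\sigma(x))$. $\mathrm{Fix}(\sigma,D_n)=\{g\in D_n:\sigma(g)=g\}$, with the order inherited from $D_n$. $\mathrm{Cycl}(\sigma,B^n)$ denotes the set of cycles (orbits, including those of length 1) of $\sigma$ acting on $B^n$, each cycle being identified with its set of elements, partially ordered by: $C\le C'$ iff there exist $x\in C$ and $y\in C'$ with $x\le y$. *)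

(* Defs.v *)
From HB Require Import structures.
From mathcomp Require Import all_boot all_order all_fingroup.

Set Implicit Arguments.
Unset Strict Implicit.
Unset Printing Implicit Defensive.

Import Order.TTheory.
Local Open Scope order_scope.

Section FfunOrder.
Context (I : finType) (d : Order.disp_t) (T : porderType d).

Definition ffun_le (f g : {ffun I -> T}) := [forall i, f i <= g i].

Fact ffun_le_refl : reflexive ffun_le.
Proof. by move=> f; apply/forallP. Qed.

Fact ffun_le_anti : antisymmetric ffun_le.
Proof.
move=> f g /andP[/forallP fg /forallP gf]; apply/ffunP => i.
by apply: le_anti; rewrite fg gf.
Qed.

Fact ffun_le_trans : transitive ffun_le.
Proof.
move=> g f h /forallP fg /forallP gh; apply/forallP => i.
exact: le_trans (fg i) (gh i).
Qed.

HB.instance Definition _ := Order.Le_isPOrder.Build d {ffun I -> T}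
  ffun_le_refl ffun_le_anti ffun_le_trans.

Lemma leEffun (f g : {ffun I -> T}) : (f <= g) = [forall i, f i <= g i].
Proof. by []. Qed.

End FfunOrder.

HB.instance Definition _ (I : finType) (d : Order.disp_t)
  (T : finPOrderType d) := Order.POrder.on {ffun I -> T}.

(* [monofun S T] is the poset T^S. *)
Record monofun (d d' : Order.disp_t) (S : finPOrderType d)
    (T : porderType d') := Monofun {
  monofun_val :> {ffun S -> T};
  _ : [forall x, forall y, (x <= y) ==> (monofun_val x <= monofun_val y)]
}.

Section MonofunOrder.
Context (d d' : Order.disp_t) (S : finPOrderType d) (T : porderType d').

HB.instance Definition _ := [isSub for @monofun_val d d' S T].
HB.instance Definition _ := [Choice of monofun S T by <:].
HB.instance Definition _ :=
  [SubChoice_isSubPOrder of monofun S T by <: with d'].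

Lemma monofun_homo (f : monofun S T) : {homo f : x y / x <= y}.
Proof.
by case: f => f /= /forallP f_homo x y; apply/implyP/(forallP (f_homo x)).
Qed.

Lemma monofunP (f : S -> T) : {homo f : x y / x <= y} ->
  [forall x, forall y, (x <= y) ==> (finfun f x <= finfun f y)].
Proof.
move=> f_homo; apply/forallP => x; apply/forallP => y.
by apply/implyP => xy; rewrite !ffunE f_homo.
Qed.

Definition mk_monofun (f : S -> T) (f_homo : {homo f : x y / x <= y}) :
  monofun S T := Monofun (monofunP f_homo).

End MonofunOrder.

HB.instance Definition _ (d d' : Order.disp_t) (S : finPOrderType d)
  (T : finPOrderType d') := [Finite of monofun S T by <:].

(* B is [bool] with its library order [false <= true]; the coordinates
   1, ..., n are 0, ..., n-1 here. *)
Definition cube (n : nat) := {ffun 'I_n -> bool}.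
HB.instance Definition _ (n : nat) := Order.FinPOrder.on (cube n).

Definition D (n : nat) := monofun (cube n) bool.
HB.instance Definition _ (n : nat) := Order.FinPOrder.on (D n).

Section Action.
Context (n : nat) (s : 'S_n).

(* [cube_act x] is x o s, i.e. s(x). *)
Definition cube_act (x : cube n) : cube n := [ffun i => x (s i)].

Fact cube_act_inj : injective cube_act.
Proof.
move=> x y /ffunP xy; apply/ffunP => i.
by have := xy ((s^-1)%g i); rewrite !ffunE permKV.
Qed.

Definition cube_perm : {perm cube n} := perm cube_act_inj.

Fact cube_perm_homo : {homo cube_perm : x y / x <= y}.
Proof.
move=> x y /forallP xy; apply/forallP => i.
by rewrite !permE !ffunE.
Qed.

Fact D_act_subproof (g : D n) : {homo g \o cube_perm : x y / x <= y}.
Proof. by move=> x y xy; apply/monofun_homo/cube_perm_homo. Qed.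

Definition D_act (g : D n) : D n := mk_monofun (@D_act_subproof g).

Record Fix := MkFix { Fix_val :> D n; _ : D_act Fix_val == Fix_val }.

HB.instance Definition _ := [isSub for Fix_val].
HB.instance Definition _ := [Finite of Fix by <:].
HB.instance Definition _ :=
  [SubChoice_isSubPOrder of Fix by <: with Order.BoolOrder.bool_display].

Record Cycl := MkCycl {
  Cycl_val :> {set cube n};
  _ : Cycl_val \in porbits cube_perm
}.

HB.instance Definition _ := [isSub for Cycl_val].
HB.instance Definition _ := [Finite of Cycl by <:].

Definition Cycl_le (C C' : Cycl) :=
  [exists x in Cycl_val C, exists y in Cycl_val C', x <= y].

End Action.

Section CyclOrder.
Context (n : nat) (s : 'S_n).
Implicit Types (x y : cube n) (C : Cycl s).

Let p := cube_perm s.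

Fact iter_cube_perm_homo i : {homo (p ^+ i)%g : x y / x <= y}.
Proof.
elim: i => [|i IHi] x y xy; first by rewrite expg0 !perm1.
by rewrite expgSr !permM; apply/cube_perm_homo/IHi.
Qed.

Fact CyclE C x : x \in Cycl_val C -> Cycl_val C = porbit p x.
Proof.
case: C => C /= /imsetP[z _ ->].
by rewrite -eq_porbit_mem => /eqP.
Qed.

(* Antisymmetry of the order on cycles: the number of 1s is constant on a
   cycle and strictly increasing on B^n. *)
Let weight x : nat := (\sum_i x i)%N.

Fact weight_cube_perm x : weight (p x) = weight x.
Proof.
rewrite /weight [RHS](reindex_inj (@perm_inj _ s)).
by apply: eq_bigr => i _; rewrite permE ffunE.
Qed.

Fact weight_porbit x y : y \in porbit p x -> weight y = weight x.
Proof.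
case/porbitP => i ->; elim: i => [|i IHi]; first by rewrite expg0 perm1.
by rewrite expgSr permM weight_cube_perm.
Qed.

Fact weight_le x y : x <= y -> (weight x <= weight y)%N.
Proof. by move=> /forallP xy; apply: leq_sum => i _; apply: xy. Qed.

Fact weight_eq x y : x <= y -> weight x = weight y -> x = y.
Proof.
move=> /forallP xy w; apply/ffunP => i; apply/eqP/contraT => nxy.
have: (weight x < weight y)%N.
  rewrite /weight (bigD1 i) //= [ltnRHS](bigD1 i) //= -addSn leq_add //.
    by have := xy i; case: (x i) nxy; case: (y i).
  by apply: leq_sum => j _; apply: xy.
by rewrite w ltnn.
Qed.

Fact Cycl_leP C C' : reflect (exists x y,
  [/\ x \in Cycl_val C, y \in Cycl_val C' & x <= y]) (Cycl_le C C').
Proof.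
apply: (iffP exists_inP) => [[x xC /exists_inP[y yC xy]]|[x [y [xC yC xy]]]].
  by exists x, y.
by exists x => //; apply/exists_inP; exists y.
Qed.

Fact Cycl_le_refl : reflexive (@Cycl_le n s).
Proof.
move=> C; case: (C) => A A_orb; case/imsetP: (A_orb) => x _ defA.
by apply/Cycl_leP; exists x, x; rewrite /= defA porbit_id lexx.
Qed.

Fact Cycl_le_anti : antisymmetric (@Cycl_le n s).
Proof.
move=> C C' /andP[/Cycl_leP[x [y [xC yC xy]]] /Cycl_leP[y' [x' [yC' xC' yx]]]].
have wx : weight x' = weight x by apply: weight_porbit; rewrite -(CyclE xC).
have wy : weight y' = weight y by apply: weight_porbit; rewrite -(CyclE yC).
have eq_xy : x = y.
  apply: weight_eq => //; apply/eqP.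
  by rewrite eqn_leq weight_le //= -wx -wy weight_le.
by apply: val_inj; rewrite /= (CyclE xC) (CyclE yC) eq_xy.
Qed.

Fact Cycl_le_trans : transitive (@Cycl_le n s).
Proof.
move=> C' C C'' /Cycl_leP[x [y [xC yC xy]]] /Cycl_leP[y' [z [yC' zC yz]]].
have: y' \in porbit p y by rewrite -(CyclE yC).
case/porbitP => i def_y'; apply/Cycl_leP; exists ((p ^+ i)%g x), z.
split=> //; first by rewrite (CyclE xC) mem_porbit.
by apply: le_trans yz; rewrite def_y'; apply: iter_cube_perm_homo.
Qed.

Fact Cycl_display : Order.disp_t. Proof. exact: Order.Disp tt tt. Qed.

HB.instance Definition _ := Order.Le_isPOrder.Build Cycl_display (Cycl s)
  Cycl_le_refl Cycl_le_anti Cycl_le_trans.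

End CyclOrder.

Section ExtPerm.
Context (k n : nat) (le_kn : (k <= n)%N) (s : 'S_k).

(* [s] permutes the indices below [k] and every index [i >= k] is fixed; see
   [ext_perm_lt] and [ext_perm_ge]. *)
Definition ext_perm_fun (t : 'S_k) (i : 'I_n) : 'I_n :=
  if insub (val i) is Some j then widen_ord le_kn (t j) else i.

Fact ext_perm_inj : injective (ext_perm_fun s).
Proof.
apply: (@can_inj _ _ _ (ext_perm_fun s^-1)) => i; rewrite /ext_perm_fun.
case: (@insubP _ _ 'I_k (val i)) => [j _ def_j | ge_i].
  rewrite (_ : insub _ = Some (s j)); last by rewrite -(valK (s j)).
  by apply: val_inj; rewrite /= permK.
by rewrite insubN.
Qed.

Definition ext_perm : 'S_n := perm ext_perm_inj.

Lemma ext_perm_lt (j : 'I_k) : 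
  ext_perm (widen_ord le_kn j) = widen_ord le_kn (s j).
Proof.
by rewrite permE /ext_perm_fun /= (_ : insub _ = Some j) // -(valK j).
Qed.

Lemma ext_perm_ge (i : 'I_n) : (k <= i)%N -> ext_perm i = i.
Proof. by move=> le_ki; rewrite permE /ext_perm_fun insubN // -leqNgt. Qed.

End ExtPerm.

Definition poset_iso (d d' : Order.disp_t) (S : porderType d)
    (T : porderType d') : Prop :=
  exists f : S -> T, bijective f /\ {mono f : x y / x <= y}.

(* Main.v *)
Require Import Defs.
From mathcomp Require Import all_boot all_order all_fingroup.

(** Both isomorphisms are forms of currying.  A bit string of length [k + m]
is a pair [(x, y)] of bit strings of lengths [k] and [m]; the order is the
product order, and the extended permutation acts on [x] only.  Hence a
monotone function [g] on [B^(k+m)] is the same as a monotone family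
[y |-> g (-, y)] of monotone functions on [B^k], and [g] is invariant exactly
when every member of the family is: this is [Fix_join_iso].

For the second isomorphism, a function on [B^k] is invariant exactly when it
is constant on cycles, that is, when it factors through the quotient map
[cycle_of] onto the poset of cycles.  The order on cycles is the image of the
order on [B^k], so monotone invariant functions correspond to monotone
functions on cycles: [Fix_Cycl_iso] gives [Fix(p, D_k) ~ B^Cycl].
Exponentiating by [B^m] ([monofun_iso]) and exchanging the two arguments
([monofun_flip_iso]) yields
[(B^Cycl)^(B^m) ~ (B^(B^m))^Cycl = D_m^Cycl]. *)

Set Implicit Arguments.
Unset Strict Implicit.
Unset Printing Implicit Defensive.

Import Order.TTheory.
Local Open Scope order_scope.

(** * Isomorphisms of posets *)

Section PosetIso.
Context (d1 d2 d3 : Order.disp_t).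
Context (S : porderType d1) (T : porderType d2) (U : porderType d3).

Lemma homo_poset_iso (f : S -> T) (g : T -> S) :
    {homo f : x y / x <= y} -> {homo g : x y / x <= y} ->
  cancel f g -> cancel g f -> poset_iso S T.
Proof.
move=> f_homo g_homo fK gK; exists f; split=> [|x y]; first by exists g.
by apply/idP/idP => [/g_homo|/f_homo //]; rewrite !fK.
Qed.

Lemma poset_iso_trans : poset_iso S T -> poset_iso T U -> poset_iso S U.
Proof.
move=> [f [f_bij f_mono]] [g [g_bij g_mono]]; exists (g \o f).
by split=> [|x y] /=; [apply: bij_comp | rewrite g_mono f_mono].
Qed.

End PosetIso.

(** * Exponentials of posets *)

Section Monofun.
Context (d d' : Order.disp_t) (S : finPOrderType d) (T : porderType d').
Implicit Types f g : monofun S T.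

Lemma monofun_leP f g : reflect (forall x, f x <= g x) (f <= g).
Proof. exact: forallP. Qed.

Lemma monofun_ext f g : f =1 g -> f = g.
Proof. by move=> fg; apply/val_inj/ffunP. Qed.

Lemma mk_monofunE (f : S -> T) (f_homo : {homo f : x y / x <= y}) :
  mk_monofun f_homo =1 f.
Proof. by move=> x; rewrite ffunE. Qed.

End Monofun.

Section MonofunComp.
Context (d d1 d2 : Order.disp_t) (S : finPOrderType d).
Context (T : porderType d1) (U : porderType d2).
Context (f : T -> U) (f_homo : {homo f : x y / x <= y}).
Implicit Type h : monofun S T.

Fact monofun_comp_subproof h : {homo f \o h : x y / x <= y}.
Proof. by move=> x y xy; apply/f_homo/monofun_homo. Qed.

Definition monofun_comp h : monofun S U :=
  mk_monofun (@monofun_comp_subproof h).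

Lemma monofun_compE h x : monofun_comp h x = f (h x).
Proof. exact: mk_monofunE. Qed.

Lemma monofun_comp_homo : {homo monofun_comp : h h' / h <= h'}.
Proof.
move=> h h' /monofun_leP hh'; apply/monofun_leP => x.
by rewrite !monofun_compE; apply/f_homo/hh'.
Qed.

End MonofunComp.

Lemma monofun_iso (d d1 d2 : Order.disp_t) (S : finPOrderType d)
    (T : porderType d1) (U : porderType d2) :
  poset_iso T U -> poset_iso (monofun S T) (monofun S U).
Proof.
move=> [f [[g fK gK] f_mono]].
have f_homo : {homo f : x y / x <= y} by move=> x y; rewrite f_mono.
have g_homo : {homo g : x y / x <= y} by move=> x y; rewrite -f_mono !gK.
apply: (homo_poset_iso (monofun_comp_homo (S := S) f_homo)
                       (monofun_comp_homo (S := S) g_homo)) => h;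
  by apply: monofun_ext => x; rewrite !monofun_compE ?fK ?gK.
Qed.

Section Flip.
Context (d1 d2 d3 : Order.disp_t).
Context (S : finPOrderType d1) (S' : finPOrderType d2) (T : porderType d3).
Implicit Type F : monofun S (monofun S' T).

Fact flip_inner_subproof F y : {homo (fun x => F x y) : x x' / x <= x'}.
Proof. by move=> x x' /(monofun_homo F)/monofun_leP. Qed.

Fact flip_outer_subproof F :
  {homo (fun y => mk_monofun (@flip_inner_subproof F y)) : y y' / y <= y'}.
Proof.
move=> y y' yy'; apply/monofun_leP => x.
by rewrite !mk_monofunE; apply: monofun_homo.
Qed.

Definition monofun_flip F : monofun S' (monofun S T) :=
  mk_monofun (@flip_outer_subproof F).

Lemma monofun_flipE F x y : monofun_flip F y x = F x y.
Proof. by rewrite !mk_monofunE. Qed.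

Lemma monofun_flip_homo : {homo monofun_flip : F G / F <= G}.
Proof.
move=> F G /monofun_leP FG; apply/monofun_leP => y; apply/monofun_leP => x.
by rewrite !monofun_flipE; have /monofun_leP := FG x.
Qed.

End Flip.

Lemma monofun_flip_iso (d1 d2 d3 : Order.disp_t) (S : finPOrderType d1)
    (S' : finPOrderType d2) (T : porderType d3) :
  poset_iso (monofun S (monofun S' T)) (monofun S' (monofun S T)).
Proof.
apply: (homo_poset_iso (@monofun_flip_homo _ _ _ S S' T)
                       (@monofun_flip_homo _ _ _ S' S T)) => F;
  by do 2!apply: monofun_ext => ?; rewrite !monofun_flipE.
Qed.

(** * Invariant monotone functions *)

(** Lets elements of [Fix s] be applied to bit strings. *)
Identity Coercion monofun_of_D : D >-> monofun.

Section Fix.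
Context (n : nat) (s : 'S_n).
Implicit Types (g h : Fix s) (x y : cube n).

Lemma Fix_leP g h : reflect (forall x, g x <= h x) (g <= h).
Proof. exact: monofun_leP. Qed.

Lemma Fix_ext g h : g =1 h -> g = h.
Proof. by move=> gh; apply/val_inj/monofun_ext. Qed.

Lemma Fix_perm g x : g (cube_perm s x) = g x.
Proof.
by case: g => g /= /eqP{2}<-; rewrite mk_monofunE.
Qed.

Lemma Fix_porbit g x y : y \in porbit (cube_perm s) x -> g y = g x.
Proof.
case/porbitP => i ->; elim: i => [|i IHi]; first by rewrite expg0 perm1.
by rewrite expgSr permM Fix_perm.
Qed.

Section MkFix.
Context (f : cube n -> bool) (f_homo : {homo f : x y / x <= y}).
Context (f_perm : forall x, f (cube_perm s x) = f x).

Fact mk_Fix_subproof : D_act s (mk_monofun f_homo) == mk_monofun f_homo.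
Proof. by apply/eqP/monofun_ext => x; rewrite !mk_monofunE /= !ffunE. Qed.

Definition mk_Fix : Fix s := MkFix mk_Fix_subproof.

Lemma mk_FixE : mk_Fix =1 f.
Proof. exact: mk_monofunE. Qed.

End MkFix.

End Fix.

(** * Factoring through the poset of cycles *)

Section FixCycl.
Context (n : nat) (s : 'S_n).
Implicit Types (g : Fix s) (x y : cube n) (C : Cycl s).

Let p := cube_perm s.

Fact porbit_in_porbits x : porbit p x \in porbits p.
Proof. exact: imset_f. Qed.

Definition cycle_of x : Cycl s := MkCycl (porbit_in_porbits x).

Lemma cycle_of_eq C x : x \in Cycl_val C -> C = cycle_of x.
Proof. by move=> xC; apply: val_inj; rewrite /= (CyclE xC). Qed.

Lemma cycle_ofP C : exists x, C = cycle_of x.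
Proof.
have: Cycl_val C \in porbits p by case: C.
by case/imsetP => x _ defC; exists x; apply: cycle_of_eq; rewrite defC porbit_id.
Qed.

Lemma cycle_of_perm x : cycle_of (p x) = cycle_of x.
Proof.
by apply/esym/cycle_of_eq/(mem_porbit p 1).
Qed.

Lemma cycle_of_homo : {homo cycle_of : x y / x <= y}.
Proof. by move=> x y xy; apply/Cycl_leP; exists x, y; rewrite !porbit_id. Qed.

(** As [g] is constant on [C], the existential is its common value there
([Cycl_valueE]); this form avoids choosing a representative of [C]. *)
Definition Cycl_value g C : bool := [exists x in Cycl_val C, g x].

Lemma Cycl_valueE g x : Cycl_value g (cycle_of x) = g x.
Proof.
apply/exists_inP/idP => [[y /Fix_porbit-> //]|gx].
by exists x; rewrite ?porbit_id.
Qed.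

(** An inequality between cycles is witnessed by elements [x <= y] of the two
cycles, and these may serve as the representatives at which [g] is read. *)
Fact Cycl_value_homo g : {homo Cycl_value g : C C' / C <= C'}.
Proof.
move=> _ _ /Cycl_leP[x [y [/cycle_of_eq-> /cycle_of_eq-> xy]]].
by rewrite !Cycl_valueE; apply: monofun_homo.
Qed.

Definition Fix_to_Cycl g : monofun (Cycl s) bool :=
  mk_monofun (@Cycl_value_homo g).

Fact comp_cycle_of_homo (h : monofun (Cycl s) bool) :
  {homo h \o cycle_of : x y / x <= y}.
Proof. by move=> x y xy; apply/monofun_homo/cycle_of_homo. Qed.

Fact comp_cycle_of_perm (h : monofun (Cycl s) bool) x :
  (h \o cycle_of) (p x) = (h \o cycle_of) x.
Proof. by rewrite /= cycle_of_perm. Qed.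

Definition Cycl_to_Fix h : Fix s := mk_Fix (@comp_cycle_of_homo h) (comp_cycle_of_perm h).

Lemma Fix_to_CyclE g x : Fix_to_Cycl g (cycle_of x) = g x.
Proof. by rewrite mk_monofunE Cycl_valueE. Qed.

Lemma Cycl_to_FixE h x : Cycl_to_Fix h x = h (cycle_of x).
Proof. exact: mk_FixE. Qed.

(** An invariant function is one that factors through the quotient map onto
the cycles. *)
Lemma Fix_Cycl_iso : poset_iso (Fix s) (monofun (Cycl s) bool).
Proof.
apply: (@homo_poset_iso _ _ _ _ Fix_to_Cycl Cycl_to_Fix).
- move=> g g' /Fix_leP gg'; apply/monofun_leP => C.
  by have [x ->] := cycle_ofP C; rewrite !Fix_to_CyclE.
- move=> h h' /monofun_leP hh'; apply/Fix_leP => x.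
  by rewrite !Cycl_to_FixE.
- by move=> g; apply: Fix_ext => x; rewrite Cycl_to_FixE Fix_to_CyclE.
- move=> h; apply: monofun_ext => C.
  by have [x ->] := cycle_ofP C; rewrite Fix_to_CyclE Cycl_to_FixE.
Qed.

End FixCycl.

(** * Currying along a concatenation of bit strings *)

Section Join.
Context (k m : nat).
Implicit Types (x : cube k) (y : cube m) (z : cube (k + m)).

Definition join x y : cube (k + m) :=
  [ffun i => match split i with inl a => x a | inr b => y b end].
Definition low z : cube k := [ffun a => z (lshift m a)].
Definition high z : cube m := [ffun b => z (rshift k b)].

Lemma join_lshift x y a : join x y (lshift m a) = x a.
Proof. by rewrite ffunE (unsplitK (inl a)). Qed.

Lemma join_rshift x y b : join x y (rshift k b) = y b.
Proof. by rewrite ffunE (unsplitK (inr b)). Qed.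

Lemma low_join x y : low (join x y) = x.
Proof. by apply/ffunP => a; rewrite ffunE join_lshift. Qed.

Lemma high_join x y : high (join x y) = y.
Proof. by apply/ffunP => b; rewrite ffunE join_rshift. Qed.

Lemma join_low_high z : join (low z) (high z) = z.
Proof.
apply/ffunP => i; rewrite -(splitK i).
by case: (split i) => j; rewrite /= (join_lshift, join_rshift) ffunE.
Qed.

Lemma low_homo : {homo low : z z' / z <= z'}.
Proof. by move=> z z' /forallP zz'; apply/forallP => a; rewrite !ffunE. Qed.

Lemma high_homo : {homo high : z z' / z <= z'}.
Proof. by move=> z z' /forallP zz'; apply/forallP => b; rewrite !ffunE. Qed.

Lemma join_homo x x' y y' : x <= x' -> y <= y' -> join x y <= join x' y'.
Proof.
move=> /forallP xx' /forallP yy'; apply/forallP => i.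
by rewrite -(splitK i); case: (split i) => j; rewrite /= !(join_lshift, join_rshift).
Qed.

Section Perm.
Context (le_k : (k <= k + m)%N) (p : 'S_k).

Lemma ext_perm_lshift a : ext_perm le_k p (lshift m a) = lshift m (p a).
Proof.
have widenE (c : 'I_k) : widen_ord le_k c = lshift m c by apply: val_inj.
by rewrite -!widenE ext_perm_lt.
Qed.

Lemma ext_perm_rshift b : ext_perm le_k p (rshift k b) = rshift k b.
Proof. by rewrite ext_perm_ge //= leq_addr. Qed.

Lemma ext_perm_join x y :
  cube_perm (ext_perm le_k p) (join x y) = join (cube_perm p x) y.
Proof.
apply/ffunP => i; rewrite permE ffunE -(splitK i).
case: (split i) => j /=.
  by rewrite ext_perm_lshift !join_lshift permE ffunE.
by rewrite ext_perm_rshift !join_rshift.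
Qed.

Lemma low_perm z : low (cube_perm (ext_perm le_k p) z) = cube_perm p (low z).
Proof. by rewrite -{1}(join_low_high z) ext_perm_join low_join. Qed.

Lemma high_perm z : high (cube_perm (ext_perm le_k p) z) = high z.
Proof. by rewrite -{1}(join_low_high z) ext_perm_join high_join. Qed.

Implicit Types (g : Fix (ext_perm le_k p)) (F : monofun (cube m) (Fix p)).

Fact slice_homo g y : {homo (fun x => g (join x y)) : x x' / x <= x'}.
Proof. by move=> x x' xx'; apply/monofun_homo/join_homo. Qed.

Fact slice_perm g y x : g (join (cube_perm p x) y) = g (join x y).
Proof. by rewrite -ext_perm_join Fix_perm. Qed.

Definition slice g y : Fix p := mk_Fix (@slice_homo g y) (slice_perm g y).

Lemma sliceE g y x : slice g y x = g (join x y).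
Proof. exact: mk_FixE. Qed.

Fact slice_family_homo g : {homo slice g : y y' / y <= y'}.
Proof.
move=> y y' yy'; apply/Fix_leP => x.
by rewrite !sliceE; apply/monofun_homo/join_homo.
Qed.

Definition slices g : monofun (cube m) (Fix p) :=
  mk_monofun (@slice_family_homo g).

Lemma slicesE g y x : slices g y x = g (join x y).
Proof. by rewrite mk_monofunE sliceE. Qed.

Fact glue_homo F : {homo (fun z => F (high z) (low z)) : z z' / z <= z'}.
Proof.
(* Move one block at a time: first the low bits, then the high bits. *)
move=> z z' zz'; apply: (@le_trans _ _ (F (high z) (low z'))).
  exact/monofun_homo/low_homo.
by have /Fix_leP := monofun_homo F (high_homo zz').
Qed.

Fact glue_perm F z (z' := cube_perm (ext_perm le_k p) z) :
  F (high z') (low z') = F (high z) (low z).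
Proof. by rewrite low_perm high_perm Fix_perm. Qed.

Definition glue F : Fix (ext_perm le_k p) :=
  mk_Fix (@glue_homo F) (glue_perm F).

Lemma glueE F z : glue F z = F (high z) (low z).
Proof. exact: mk_FixE. Qed.

(** Currying, restricted to invariant functions: since the permutation leaves
the last [m] bits alone, invariance can be tested one slice at a time. *)
Lemma Fix_join_iso :
  poset_iso (Fix (ext_perm le_k p)) (monofun (cube m) (Fix p)).
Proof.
apply: (@homo_poset_iso _ _ _ _ slices glue).
- move=> g g' /Fix_leP gg'; apply/monofun_leP => y; apply/Fix_leP => x.
  by rewrite !slicesE.
- move=> F F' /monofun_leP FF'; apply/Fix_leP => z.
  by rewrite !glueE; have /Fix_leP := FF' (high z).
- by move=> g; apply: Fix_ext => z; rewrite glueE slicesE join_low_high.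
- move=> F; apply: monofun_ext => y; apply: Fix_ext => x.
  by rewrite slicesE glueE high_join low_join.
Qed.

End Perm.
End Join.

(** * The two isomorphisms *)

Local Close Scope order_scope.

Theorem lemma5 (n k m : nat) (hk : 1 <= k) (hkn : k < n) (hm : m = n - k)
    (p : 'S_k) :
  poset_iso (Fix (ext_perm (ltnW hkn) p)) (monofun (cube m) (Fix p)) /\
  poset_iso (monofun (cube m) (Fix p)) (monofun (Cycl p) (D m)).
Proof.
split.
  have n_eq : n = k + m by rewrite hm subnKC // ltnW.
  (* [hm] must go, or it would become a circular equation for [m]. *)
  by clear hm; subst n; apply: Fix_join_iso.
apply: poset_iso_trans (monofun_iso _ (Fix_Cycl_iso p)) _.
exact: monofun_flip_iso.
Qed.
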